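(* Let $(X,\rho)$ be a metric space, let $[a,b]\subset\mathbb R$ be a segment, and let $\gamma\colon [a,b]\to X$ be a continuous mapping. Then $\gamma$ is absolutely continuous if and only if for every Lipschitz function $h\colon X\to\mathbb R$ the composition $h\circ\gamma\colon [a,b]\to\mathbb R$ is absolutely continuous.
   Context: A mapping $\gamma\colon [a,b]\to X$ of a segment $[a,b]\subset\mathbb R$ to a metric space $(X,\rho)$ is called absolutely continuous if for every $\varepsilon>0$ there exists $\delta>0$ such that for any finite collection of pairwise disjoint intervals $(a_i,b_i)\subset[a,b]$ the inequality $\sum_i (b_i-a_i)<\delta$ implies $\sum_i \rho(\gamma(a_i),\gamma(b_i))<\varepsilon$. For real-valued functions this is applied with $X=\mathbb R$ and the usual metric $|x-y|$. A function $h\colon X\to\mathbb R$ is Lipschitz if there is a constant $L\ge 0$ with $|h(x)-h(y)|\le L\rho(x,y)$ for all $x,y\in X$. *)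

(* Defs.v *)
From mathcomp Require Import all_boot all_order all_algebra.
From mathcomp Require Import all_classical all_reals all_analysis.

Set Implicit Arguments.
Unset Strict Implicit.
Unset Printing Implicit Defensive.

Import Order.TTheory GRing.Theory Num.Theory.
Import numFieldNormedType.Exports.

Local Open Scope classical_set_scope.
Local Open Scope ring_scope.

(* A map on the segment [a, b] is represented by a total function on R of which
   only the values on [a, b] are used. *)
Definition abs_continuous_on (R : realType) (X : metricType R) (a b : R)
    (f : R -> X) : Prop :=
  forall e : R, 0 < e -> exists2 d : R, 0 < d &
    forall (n : nat) (u v : 'I_n -> R),
      (forall i, a <= u i /\ u i < v i /\ v i <= b) ->
      trivIset [set: 'I_n] (fun i => `]u i, v i[%classic) ->
      \sum_(i < n) (v i - u i) < d ->
      \sum_(i < n) mdist (f (u i)) (f (v i)) < e.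

(* The library's [lipschitz] is restricted to maps between normed modules. *)
Definition metric_lipschitz (R : realType) (X : metricType R) (h : X -> R) :
    Prop :=
  exists2 L : R, 0 <= L & forall x y : X, `|h x - h y| <= L * mdist x y.

(* Main.v *)
(* Write g_h for the density of h o gamma. If f1 and f2 are 1-Lipschitz, times t
   and s with gamma t = gamma s at which (f1, f2) o gamma has non-parallel
   velocities form isolated, hence countably many, pairs; so up to a small set
   of times, gamma separates the times where |g_f1| dominates from those where
   |g_f2| dominates. A fine zigzag of f1 near the first image and of f2 near the
   second is then a single 1-Lipschitz h with |g_h| >= max(|g_f1|, |g_f2|), and
   finitely many functions can be treated in the same way. By uniform
   boundedness the integral of |g_h| is bounded over all 1-Lipschitz h; an h0
   almost attaining the supremum satisfies, for 1-Lipschitz f_i and disjoint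
   intervals J_i,
     sum_i int_(J_i) |g_(f_i)| <= int_(U_i J_i) |g_h0| + small,
   and f_i = mdist (gamma u_i) gives the absolute continuity of gamma. *)

From HB Require Import structures.
Require Import Defs.
From mathcomp Require Import all_boot all_order all_algebra.
From mathcomp Require Import all_classical all_reals all_analysis.
From mathcomp Require Import measurable_realfun.
From mathcomp Require Import zify ring lra.

Set Implicit Arguments.
Unset Strict Implicit.
Unset Printing Implicit Defensive.

Import Order.TTheory GRing.Theory Num.Theory.
Import numFieldNormedType.Exports.

Local Open Scope classical_set_scope.
Local Open Scope ring_scope.

(** * Densities of absolutely continuous functions *)

(** Degenerate intervals contribute zero to both sums, so they are discarded and the others
    enumerated. Clamped intervals and the pieces of several partitions come in this general form. *)
Lemma abs_continuous_on_fin (R : realType) (X : metricType R) (a b : R)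
    (f : R -> X) :
  abs_continuous_on a b f ->
  forall e : R, 0 < e -> exists2 d : R, 0 < d &
    forall (I : finType) (u v : I -> R),
      (forall i, [/\ a <= u i, u i <= v i & v i <= b]) ->
      trivIset [set: I] (fun i => `]u i, v i[%classic) ->
      \sum_i (v i - u i) < d ->
      \sum_i mdist (f (u i)) (f (v i)) < e.
Proof.
move=> acf e /acf[d d0 df]; exists d => // I u v uv tuv uvd.
pose J := [pred i | u i < v i].
have sumJ (F : I -> R) : (forall i, ~~ J i -> F i = 0) ->
    \sum_i F i = \sum_(i < #|J|) F (enum_val i).
  move=> F0; rewrite -(big_enum_val (A := J) F) [RHS]big_mkcond/=.
  by apply: eq_bigr => i _; case: ifPn => // /F0.
have NJ i : ~~ J i -> u i = v i.
  rewrite /J/= -leNgt => vu; apply/eqP; rewrite eq_le vu andbT.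
  by have [] := uv i.
rewrite sumJ; last by move=> i /NJ ->; rewrite mdistxx.
apply: (df _ (u \o enum_val) (v \o enum_val)).
- by move=> i; have := enum_valP i; have [] := uv (enum_val i).
- apply/trivIsetP => i j _ _ ij /=; move/trivIsetP : tuv; apply => //.
  by apply: contra ij => /eqP/enum_val_inj ->.
- by rewrite /= -(sumJ (fun i => v i - u i))// => i /NJ ->; rewrite subrr.
Qed.

Lemma abs_continuous_on_uniform (R : realType) (X : metricType R) (a b : R)
    (f : R -> X) :
  abs_continuous_on a b f ->
  forall e : R, 0 < e -> exists2 d : R, 0 < d &
    forall s t, a <= s -> s <= t -> t <= b -> t - s < d -> mdist (f s) (f t) < e.
Proof.
move=> /abs_continuous_on_fin acf e /acf[d d0 df]; exists d => // s t as_ st tb.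
have := df _ (fun _ : 'I_1 => s) (fun _ => t).
rewrite !big_ord1; apply; first by split.
by apply/trivIsetP => i j _ _; rewrite !ord1.
Qed.

Lemma itv_partition_nth_bounds (R : realType) (a b : R) (s : seq R) (i : nat) :
  itv_partition a b s -> (i < size s)%N ->
  [/\ a <= nth b (a :: s) i, nth b (a :: s) i < nth b s i & nth b s i <= b].
Proof.
move=> [+ /eqP]; elim: s a i => [//|x s IH] a i /= /andP[ax xs] lastb.
have xb : x <= b.
  case: s {IH} xs lastb => [_ /= -> //|y s xs <-].
  have := order_path_min lt_trans xs; move=> /allP/(_ (last y s)).
  by rewrite mem_last => /(_ isT)/ltW.
case: i => [_/=|i]; first by split.
rewrite ltnS => /(IH x i xs lastb)[xi ii ib]; split => //.
by rewrite (le_trans (ltW ax)).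
Qed.

Lemma itv_partition_trivIset (R : realType) (a b : R) (s : seq R) :
  itv_partition a b s ->
  trivIset [set: 'I_(size s)]
    (fun i => `]nth b (a :: s) i, nth b s i[%classic).
Proof.
move=> abs; have sorted_abs : sorted <%R (a :: s) by case: abs.
have le_nth i j : (i <= j)%N -> (j <= size s)%N ->
    nth b (a :: s) i <= nth b (a :: s) j.
  move=> ij js; apply: (sorted_leq_nth _ _ _ _ _ _ _ _ ij); rewrite ?inE//=.
  - exact: le_trans.
  - by apply: sub_sorted sorted_abs => x y /ltW.
  - exact: leq_trans ij js.
suff H (i j : 'I_(size s)) : (i < j)%N ->
    `]nth b (a :: s) i, nth b s i[ `&` `]nth b (a :: s) j, nth b s j[ = set0.
  apply/trivIsetP => i j _ _; rewrite neq_ltn => /orP[|] ?; first exact: H.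
  by rewrite setIC; exact: H.
move=> ij; rewrite -subset0 => x []/=; rewrite !in_itv/=.
move=> /andP[_ xi] /andP[jx _].
have := lt_trans jx xi; rewrite ltNge => /negP; apply.
by apply: (le_nth i.+1) => //; exact: ltnW.
Qed.

(** Partition every interval: the pieces form one disjoint family of the same total length, so
    absolute continuity bounds the sum of all the variations at once. The strict bound becomes weak
    when suprema are taken. *)
Lemma abs_continuous_on_sum_total_variation (R : realType) (a b : R)
    (F : R -> R) :
  @abs_continuous_on R R^o a b F ->
  forall e : R, 0 < e -> exists2 d : R, 0 < d &
    forall n (u v : 'I_n -> R),
      (forall i, [/\ a <= u i, u i <= v i & v i <= b]) ->
      trivIset [set: 'I_n] (fun i => `]u i, v i[%classic) ->
      \sum_i (v i - u i) < d ->
      (\sum_i total_variation (u i) (v i) F <= e%:E)%E.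
Proof.
move=> /abs_continuous_on_fin acF e /acF[d d0 dF]; exists d => // n u v uv tuv uvd.
have TVsup i : total_variation (u i) (v i) F = ereal_sup [set x%:E | x in
    [set variation (u i) (v i) F s | s in itv_partition (u i) (v i)]] by [].
suff H (s : 'I_n -> seq R) : (forall i, itv_partition (u i) (v i) (s i)) ->
    \sum_i variation (u i) (v i) F (s i) < e.
  have nonempty i : exists s, itv_partition (u i) (v i) s.
    have [_ uvi _] := uv i; move: uvi; rewrite le_eqVlt => /predU1P[->|uvi].
      by exists [::]; split.
    by exists [:: v i]; exact: itv_partition1.
  have [s0 s0P] := choice nonempty.
  have fin i : total_variation (u i) (v i) F \is a fin_num.
    have [_ uvi _] := uv i; apply/bounded_variationP => //.
    exists e => _ [s sP <-].
    (* Only the [i]-th partition varies; the other variations are nonnegative. *)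
    have := H (fun j => if pselect (i = j) is left E then s else s0 j).
    have sP' j : itv_partition (u j) (v j)
        (if pselect (i = j) is left _ then s else s0 j).
      by case: pselect => // <-.
    move=> /(_ sP')/ltW; apply: le_trans; rewrite (bigD1 i)//=.
    case: pselect => //= _; rewrite lerDl sumr_ge0// => j _.
    exact: variation_ge0.
  apply/lee_addgt0Pr => r r0; rewrite -EFinD.
  (* The slack [r] is shared among the [n] intervals; [n.+1] is positive even for [n = 0]. *)
  pose r' := r / n.+1%:R.
  have r'0 : 0 < r' by rewrite divr_gt0.
  have approx i : exists s, itv_partition (u i) (v i) s /\
      (total_variation (u i) (v i) F < (variation (u i) (v i) F s + r')%:E)%E.
    have := fin i; rewrite TVsup => fini.
    have [_ [_ [s sP <-] <-] lts] := ub_ereal_sup_adherent r'0 fini.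
    by exists s; split => //; rewrite EFinD -lteBlDr.
  have [s /all_and2[sP sTV]] := choice approx.
  apply: (@le_trans _ _ (\sum_i (variation (u i) (v i) F (s i) + r')%:E)%E).
    by apply: lee_sum => i _; exact/ltW.
  rewrite sumEFin lee_fin big_split/= lerD//; first exact/ltW/H.
  rewrite sumr_const card_ord -mulr_natr /r' -mulrA ger_pMr//.
  by rewrite mulrC ler_pdivrMr// mul1r ler_nat.
move=> sP.
pose I := {i : 'I_n & 'I_(size (s i))}.
pose U (p : I) := nth (v (tag p)) (u (tag p) :: s (tag p)) (tagged p).
pose V (p : I) := nth (v (tag p)) (s (tag p)) (tagged p).
have sumI (f : R -> R -> R) : \sum_(p : I) f (U p) (V p) =
    \sum_i \sum_(j < size (s i))
      f (nth (v i) (u i :: s i) j) (nth (v i) (s i) j).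
  by rewrite sig_big_dep.
have UV (p : I) : [/\ u (tag p) <= U p, U p < V p & V p <= v (tag p)].
  exact: itv_partition_nth_bounds.
have := dF I U V.
rewrite (sumI (fun x y => @mdist R R^o (F x) (F y))) (sumI (fun x y => y - x)).
rewrite /variation.
rewrite [X in X < e](_ : _ = \sum_i variation (u i) (v i) F (s i)); last first.
  by apply: eq_bigr => i _; rewrite /variation big_mkord.
apply.
- move=> p; have [uU UVp Vv] := UV p; have [au _ vb] := uv (tag p).
  by split; [exact: le_trans uU|exact: ltW|exact: le_trans vb].
- apply/trivIsetP => -[i k] [j l] _ _ ijkl.
  have [ij|ij] := eqVneq i j.
    case: _ / ij l ijkl => l kl.
    have /trivIsetP := itv_partition_trivIset (sP i); apply => //.
    by apply: contra kl => /eqP/= ->.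
  move/trivIsetP : tuv => /(_ i j Logic.I Logic.I ij).
  apply: subsetI_eq0 => x; rewrite /= !in_itv/= => /andP[Ux xV].
    have [uU _ Vv] := UV (existT _ i k).
    by rewrite (le_lt_trans uU Ux) (lt_le_trans xV Vv).
  have [uU _ Vv] := UV (existT _ j l).
  by rewrite (le_lt_trans uU Ux) (lt_le_trans xV Vv).
- apply: le_lt_trans uvd; apply: ler_sum => i _.
  (* The lengths of the pieces add up as the variation of the identity. *)
  have := @nondecreasing_variation _ (u i) (v i) id (s i) _ (sP i).
  rewrite /variation big_mkord => <-//.
  by apply: ler_sum => j _; exact: ler_norm.
Qed.

(** Intervals shorter than [d] have variation at most 1, and finitely many steps of length [d / 2]
    exhaust [[a, b]]. *)
Lemma abs_continuous_on_bounded_variation (R : realType) (a b : R)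
    (F : R -> R) :
  a <= b -> @abs_continuous_on R R^o a b F ->
  total_variation a b F \is a fin_num.
Proof.
move=> ab /abs_continuous_on_sum_total_variation acF.
have [d d0 dF] := acF 1 ltr01.
have short s t : a <= s -> s <= t -> t <= b -> t - s < d ->
    (total_variation s t F <= 1)%E.
  move=> as_ st tb std.
  have := dF 1 (fun _ => s) (fun _ => t); rewrite !big_ord1; apply => //.
  by apply/trivIsetP => i j _ _; rewrite !ord1.
suff H n s : a <= s -> s <= b -> b - s <= n%:R * (d / 2) ->
    (total_variation s b F <= n%:R%:E)%E.
  have [n bn] : exists n : nat, b - a <= n%:R * (d / 2).
    exists (Num.truncn ((b - a) / (d / 2))).+1.
    rewrite -ler_pdivrMr ?divr_gt0//; apply/ltW/truncnS_gt.
  rewrite ge0_fin_numE ?total_variation_ge0//.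
  exact: le_lt_trans (H _ _ (lexx _) ab bn) (ltry _).
elim: n s => [|n IH] s as_ sb.
  rewrite mul0r subr_le0 => bs.
  by rewrite (le_anti (introT andP (conj sb bs))) total_variationxx.
move=> bsn; have [bsd|dbs] := ltP (b - s) d.
  apply: le_trans (short _ _ as_ sb (lexx _) bsd) _.
  by rewrite lee_fin ler1n.
have d20 : 0 < d / 2 by rewrite divr_gt0.
have sm : s <= s + d / 2 by rewrite lerDl ltW.
have mb : s + d / 2 <= b.
  by rewrite -lerBrDl (le_trans _ dbs)// ler_pdivrMr// ler_peMr ?ler1n// ltW.
rewrite (total_variationD _ sm mb) -[n.+1%:R]natr1 EFinD addeC.
apply: leeD; last first.
  apply: short => //; rewrite addrAC subrr add0r.
  by rewrite ltr_pdivrMr// ltr_pMr// ltr1n.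
apply: IH => //; first exact: le_trans sm.
by rewrite opprD addrA lerBlDr (le_trans bsn)// -[n.+1%:R]natr1 mulrDl mul1r.
Qed.

Lemma open_interval_bounded (R : realType) (A : set R) :
  open A -> is_interval A -> has_lbound A -> has_ubound A -> exists u v,
  u <= v /\ A = `]u, v[%classic.
Proof.
move=> oA iA lA uA; have [->|A0] := eqVneq A set0.
  by exists 0, 0; split => //; rewrite set_itvoo0.
exists (inf A), (sup A); split.
  have [x Ax] : A !=set0 by exact/set0P.
  by rewrite (@le_trans _ _ x)//; [exact: ge_inf|exact: ub_le_sup].
by rewrite -interval_bounded_interior// (interior_id A).1.
Qed.


Definition has_density (R : realType) (a b : R) (F g : R -> R) : Prop :=
  (@lebesgue_measure R).-integrable setT (EFin \o g) /\
  forall s t, a <= s -> s <= t -> t <= b ->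
    F t - F s = \int[@lebesgue_measure R]_(x in `]s, t]) g x.

(** The Lebesgue-Stieltjes measure of [G] on []a, b]] is absolutely continuous with respect to
    Lebesgue measure; its Radon-Nikodym derivative is the density. *)
Lemma nondecreasing_density (R : realType) (a b : R) (G : R -> R) :
  a <= b -> {in `[a, b] &, nondecreasing_fun G} ->
  @abs_continuous_on R R^o a b G ->
  exists g : R -> R, [/\ has_density a b G g, forall x, 0 <= g x &
    \int[@lebesgue_measure R]_x g x = G b - G a].
Proof.
move=> ab ndG acG.
(* Clamping to [[a, b]] makes [G] monotone and right continuous on the whole line, as a cumulative
   function must be. *)
pose c x := Order.max a (Order.min x b).
have cab x : c x \in `[a, b].
  by rewrite in_itv/= /c le_max lexx/= ge_max ab/= ge_min lexx orbT.
have c_id x : a <= x -> x <= b -> c x = x.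
  by move=> ax xb; rewrite /c min_l// max_r.
have cD x y : x <= y -> c x <= c y /\ c y - c x <= y - x.
  move=> xy; rewrite /c /Order.max /Order.min.
  by do ! case: ifPn; rewrite -?leNgt => *; split; lra.
pose Gc x := G (c x).
have ndGc : nondecreasing_fun Gc.
  by move=> x y xy; apply: ndG => //; have [] := cD _ _ xy.
have rcGc : right_continuous Gc.
  apply: right_continuousW => x; apply/cvgrPdist_lt => e e0.
  have [d d0 dG] := abs_continuous_on_uniform acG e0.
  have key y z : y <= z -> z - y < d -> `|Gc z - Gc y| < e.
    move=> yz zyd; have [cyz czy] := cD _ _ yz.
    have /andP[ac _] := cab y; have /andP[_ cb] := cab z.
    by apply: dG => //; rewrite (le_lt_trans czy).
  near=> y.
  have xyd : `|x - y| < d by near: y; exact: cvgr_dist_lt.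
  have [xy|/ltW yx] := leP x y.
    rewrite distrC; apply: key => //; move: xyd.
    by rewrite distrC ger0_norm// subr_ge0.
  by apply: key => //; move: xyd; rewrite ger0_norm// subr_ge0.
pose Gcum : cumulative R R :=
  HB.pack_for (cumulative R R) Gc (isCumulative.Build R _ R Gc ndGc rcGc).
pose nu0 := lebesgue_stieltjes_measure Gcum.
have nu0E s t : s <= t -> nu0 `]s, t]%classic = (Gc t - Gc s)%:E.
  move=> st; rewrite /nu0 /lebesgue_stieltjes_measure /measure_extension.
  by rewrite measurable_mu_extE/= ?wlength_itv_bnd//; exact: is_ocitv.
have nu0oo s t : s <= t -> (nu0 `]s, t[%classic <= (Gc t - Gc s)%:E)%E.
  move=> st; rewrite -nu0E//; apply: le_measure; rewrite ?inE//.
  exact: subset_itvW.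
have mD : measurable (`]a, b]%classic : set (measurableTypeR R)) by [].
have Doo : (nu0 `]a, b]%classic < +oo)%E by rewrite nu0E// ltry.
pose nu : {finite_measure set (measurableTypeR R) -> \bar R} := mfrestr mD Doo.
have nu_dom : nu `<< @lebesgue_measure R.
  apply/null_content_dominatesP => A mA A0; apply/eqP; rewrite -measure_le0.
  apply/lee_addgt0Pr => e e0; rewrite add0e -[leLHS]/(nu0 (A `&` `]a, b])).
  have [d d0 dG] := abs_continuous_on_fin acG e0.
  have AD0 : lebesgue_measure (A `&` `]a, b]) = 0.
    apply/eqP; rewrite -measure_le0 -A0 le_measure ?inE//.
    exact: measurableI.
  have mAD : measurable (A `&` `]a, b]) by exact: measurableI.
  have [|U [oU ADU Ud]] := lebesgue_regularity_outer mAD _ d0.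
    by rewrite [ltLHS]AD0.
  (* Truncation keeps the components of the open cover bounded, so that they have endpoints. *)
  pose W := U `&` `](a - 1), (b + 1)[.
  have oW : open W by apply: openI => //; exact: interval_open.
  have ADW : A `&` `]a, b] `<=` W.
    move=> x ADx; split; first exact: ADU.
    move: ADx => [_] /=; rewrite !in_itv/= => /andP[ax xb].
    by apply/andP; split; lra.
  have Wd : (lebesgue_measure W < d%:E)%E.
    apply: le_lt_trans Ud; rewrite -[leRHS]adde0 -[X in (_ + X)%E]AD0.
    apply: (@le_trans _ _
      (lebesgue_measure ((U `\` (A `&` `]a, b])) `|` (A `&` `]a, b])))).
      apply: le_measure; rewrite ?inE.
      - exact: open_measurable.
      - by apply: measurableU => //; apply: measurableD => //;
          exact: open_measurable.
      - move=> x [Ux _].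
        by have [|] := pselect ((A `&` `]a, b]) x); [right|left].
    by apply: measureU2 => //; apply: measurableD => //; exact: open_measurable.
  pose I := open_disjoint_itv oW.
  have WI : W = \bigcup_k I k by exact: open_disjoint_itv_bigcup.
  have tI : trivIset setT I by exact: open_disjoint_itv_trivIset.
  have oI k : open (I k) by exact: open_disjoint_itv_open.
  have uvI k : exists uv : R * R, uv.1 <= uv.2 /\ I k = `]uv.1, uv.2[%classic.
    have IW : I k `<=` `](a - 1), (b + 1)[.
      by move=> x Ix; have : W x by [rewrite WI; exists k]; move=> [].
    have [] := @open_interval_bounded R (I k).
    - exact: oI.
    - exact: open_disjoint_itv_is_interval.
    - by exists (a - 1) => x /IW/=; rewrite in_itv/= => /andP[/ltW].
    - by exists (b + 1) => x /IW/=; rewrite in_itv/= => /andP[_ /ltW].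
    by move=> u [v uvP]; exists (u, v).
  have [w /all_and2[w12 wI]] := choice uvI.
  have sumI (m : {measure set (measurableTypeR R) -> \bar R}) :
      m W = (\sum_(0 <= k <oo) m (I k))%E.
    rewrite WI measure_bigcup//=; last first.
      by move=> k _; exact: open_measurable.
    by apply: eq_eseriesl => k; exact: in_setT.
  apply: (@le_trans _ _ (nu0 W)).
    by apply: le_measure; rewrite ?inE//; exact: open_measurable.
  rewrite [leLHS](sumI (lebesgue_stieltjes_measure Gcum)).
  (* The Stieltjes measure of [W] is a limit of finite partial sums, to which the absolute
     continuity of [G] applies once the endpoints are clamped. *)
  apply: lime_le; first exact: is_cvg_nneseries.
  apply: nearW => n; rewrite big_mkord.
  apply: (@le_trans _ _ (\sum_(k < n) (Gc (w k).2 - Gc (w k).1)%:E)%E).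
    by apply: lee_sum => k _; rewrite wI; exact: nu0oo.
  rewrite sumEFin lee_fin; apply/ltW.
  apply: le_lt_trans (dG _ (fun k : 'I_n => c (w k).1) (fun k => c (w k).2) _ _ _).
  - by apply: ler_sum => k _; exact: ler_norm.
  - move=> k; have := cab (w k).1; have := cab (w k).2.
    by rewrite !in_itv/= => /andP[_ ->] /andP[-> _]; have [] := cD _ _ (w12 k).
  - apply/trivIsetP => i j _ _ ij.
    have cI k : `]c (w k).1, c (w k).2[ `<=` I k.
      move=> x; rewrite wI/= !in_itv/= /c /Order.max /Order.min.
      by do ! case: ifPn; rewrite -?leNgt => *; lra.
    have /trivIsetP/(_ i j Logic.I Logic.I ij) := tI.
    by apply: subsetI_eq0; exact: cI.
  - rewrite -lte_fin; apply: le_lt_trans Wd; rewrite [leRHS](sumI lebesgue_measure).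
    apply: (@le_trans _ _ (\sum_(0 <= k < n) lebesgue_measure (I k))%E); last first.
      exact: nneseries_lim_ge.
    rewrite big_mkord -sumEFin; apply: lee_sum => k _.
    rewrite wI lebesgue_measure_itv/= lte_fin.
    have [_ cw] := cD _ _ (w12 k); case: ifPn => [_|].
      by rewrite -EFinB lee_fin.
    by rewrite -leNgt lee_fin => w21; lra.
have [g' [g'0 g'fin g'int g'E]] := radon_nikodym_sigma_finite nu_dom.
have g'_fine : EFin \o (fine \o g') = g'.
  by apply/funext => x /=; rewrite fineK.
exists (fine \o g'); split.
- split; first by rewrite g'_fine.
  move=> s t as_ st tb; rewrite /Rintegral.
  rewrite (_ : (fun _ => _) = g'); last by rewrite -g'_fine.
  rewrite -g'E// -[nu _]/(nu0 (`]s, t] `&` `]a, b])) setIidl; last first.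
    exact: subset_itv.
  by rewrite nu0E// /Gc !c_id// ?(le_trans st)// (le_trans as_).
- by move=> x; rewrite fine_ge0.
- rewrite /Rintegral (_ : (fun _ => _) = g'); last by rewrite -g'_fine.
  rewrite -g'E// -[nu _]/(nu0 (setT `&` `]a, b])) setTI nu0E//.
  by rewrite /Gc !c_id.
Unshelve. all: by end_near. Qed.

Lemma has_density_integrable (R : realType) (a b : R) (F g : R -> R)
    (D : set (measurableTypeR R)) : measurable D -> has_density a b F g ->
  (@lebesgue_measure R).-integrable D (EFin \o g).
Proof. by move=> mD [+ _]; exact: integrableS. Qed.

Lemma has_densityB (R : realType) (a b : R) (F G f g : R -> R) :
  has_density a b F f -> has_density a b G g ->
  has_density a b (fun x => F x - G x) (fun x => f x - g x).
Proof.
move=> Ff Gg; split.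
  by apply: (integrableB _ Ff.1 Gg.1).
move=> s t as_ st tb; rewrite RintegralB//.
- by rewrite -(Ff.2 _ _ as_ st tb) -(Gg.2 _ _ as_ st tb); ring.
- exact: has_density_integrable Ff.
- exact: has_density_integrable Gg.
Qed.

(** Jordan decomposition: with [V] the variation function, [F] is the difference of [(V + F) / 2]
    and [(V - F) / 2]. Both are nondecreasing and absolutely continuous, and the integrals of their
    nonnegative densities add up to the total variation. *)
Lemma abs_continuous_on_density (R : realType) (a b : R) (F : R -> R) :
  a <= b -> @abs_continuous_on R R^o a b F ->
  exists2 g : R -> R, has_density a b F g &
    \int[@lebesgue_measure R]_x `|g x| <= fine (total_variation a b F).
Proof.
move=> ab acF.
pose V t := fine (total_variation a t F).
have TVfin s t : a <= s -> s <= t -> t <= b ->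
    total_variation s t F \is a fin_num.
  move=> as_ st tb; have := abs_continuous_on_bounded_variation ab acF.
  move/bounded_variationP => /(_ ab) bv; apply/bounded_variationP => //.
  apply: (bounded_variationr as_ st); apply: bounded_variationl bv => //.
  exact: le_trans st.
have VB s t : a <= s -> s <= t -> t <= b ->
    V t - V s = fine (total_variation s t F).
  move=> as_ st tb; rewrite /V (total_variationD _ as_ st) fineD ?TVfin//.
    by rewrite addrAC subrr add0r.
  exact: le_trans tb.
have FV s t : a <= s -> s <= t -> t <= b -> `|F t - F s| <= V t - V s.
  move=> as_ st tb; rewrite VB// -lee_fin fineK ?TVfin//.
  exact: total_variation_ge.
(* Increments dominated by those of [V] inherit absolute continuity from the bound on sums of total
   variations. *)
have acV (G : R -> R) :
    (forall s t, a <= s -> s <= t -> t <= b -> `|G t - G s| <= V t - V s) ->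
    @abs_continuous_on R R^o a b G.
  move=> GV e e0; have e20 : 0 < e / 2 by rewrite divr_gt0.
  have [d d0 dF] := abs_continuous_on_sum_total_variation acF e20.
  exists d => // n u v uv tuv uvd.
  have uv' i : [/\ a <= u i, u i <= v i & v i <= b].
    by have [? [/ltW]] := uv i.
  apply: (@le_lt_trans _ _ (e / 2)); last by rewrite ltr_pdivrMr// ltr_pMr// ltr1n.
  rewrite -lee_fin -sumEFin; apply: le_trans (dF n u v uv' tuv uvd).
  apply: lee_sum => i _; have [au uvi vb] := uv' i.
  by rewrite -[leRHS]fineK ?TVfin// lee_fin -VB//; exact: GV.
have part (e : R) : `|e| = 1 -> exists g : R -> R,
    [/\ has_density a b (fun x => (V x + e * F x) / 2) g, forall x, 0 <= g x &
      \int[@lebesgue_measure R]_x g x =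
        (V b + e * F b) / 2 - (V a + e * F a) / 2].
  move=> e1.
  have eF s t : a <= s -> s <= t -> t <= b ->
      `|e * F t - e * F s| <= V t - V s.
    by move=> *; rewrite -mulrBr normrM e1 mul1r FV.
  apply: nondecreasing_density => //.
    move=> s t; rewrite !in_itv/= => /andP[as_ _] /andP[_ tb] st.
    by have := eF _ _ as_ st tb; rewrite ler_norml => /andP[? _]; lra.
  apply: acV => s t as_ st tb.
  by have := eF _ _ as_ st tb; rewrite !ler_norml => /andP[? ?]; apply/andP; lra.
have [p [Fp p0 intp]] := part 1 (normr1 _).
have [n [Fn n0 intn]] := part (- 1) (normrN1 _).
exists (fun x => p x - n x).
  have := has_densityB Fp Fn; congr (has_density _ _ _ _).
  by apply/funext => x; lra.
have Va : V a = 0 by rewrite /V total_variationxx.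
have -> : fine (total_variation a b F) = \int[@lebesgue_measure R]_x (p x + n x).
  rewrite RintegralD ?intp ?intn//; [|exact: Fp.1|exact: Fn.1].
  by rewrite -[LHS]/(V b) Va; lra.
apply: le_Rintegral => //.
- have := integrable_abse (integrableB measurableT Fp.1 Fn.1).
  by apply: eq_integrable.
- exact: (integrableD measurableT Fp.1 Fn.1).
- move=> x _; rewrite (le_trans (ler_normB _ _))//.
  by rewrite !ger0_norm.
Qed.

(** Differentiability at [t] with derivative [l], without a quotient, so that [s = t] needs no
    exception. *)
Definition slope_at (R : realType) (F : R -> R) (t l : R) : Prop :=
  forall e : R, 0 < e -> exists2 r : R, 0 < r &
    forall s, `|s - t| < r -> `|F s - F t - l * (s - t)| <= e * `|s - t|.

(** Almost every [t] is a Lebesgue point of [g], and there the indefinite integral has derivative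
    [g t]. *)
Lemma has_density_slope (R : realType) (a b : R) (F g : R -> R) :
  has_density a b F g ->
  {ae (@lebesgue_measure R), forall t, a < t -> t < b -> slope_at F t (g t)}.
Proof.
move=> [intg FE].
have := lebesgue_differentiation (open_integrable_locally openT intg).
apply: filterS; first exact: (ae_filter_ringOfSetsType (@lebesgue_measure R)).
move=> t gt at_ tb.
have intgb : (@lebesgue_measure R).-integrable
    [set` Interval (BRight a) (BRight b)] (EFin \o g).
  exact: integrableS intg.
have aBt : (BRight a < BRight t)%O by rewrite bnd_simp.
have [dP] := FTC1_lebesgue_pt tb intgb aBt gt.
rewrite derive1E => dPE e e0.
move: dP; rewrite /derivable -/(derive _ _ _) => /cvgrPdist_le.
rewrite -/(derive _ _ _) dPE => /(_ e e0).
rewrite -nbhs_nearE => -[/= r r0 rP].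
(* This radius keeps [s] inside [[a, b]], where increments of [F] are integrals of [g]. *)
exists (Num.min r (Num.min (t - a) (b - t))).
  by rewrite !lt_min r0 !subr_gt0 at_ tb.
move=> s; rewrite !lt_min => /and3P[sr sa sb].
have [->|st] := eqVneq s t; first by rewrite !subrr mulr0 subr0 normr0 mulr0.
have st0 : s - t != 0 by rewrite subr_eq0.
have as_ : a <= s by move: sa; rewrite ltr_norml => /andP[? _]; lra.
have sb_ : s <= b by move: sb; rewrite ltr_norml => /andP[_ ?]; lra.
have := rP (s - t); rewrite /= sub0r normrN => /(_ sr st0).
rewrite [_ *: 1]mulr1 subrK.
have PhiE y : a <= y -> y <= b ->
    \int[@lebesgue_measure R]_(x in `]a, y]) g x = F y - F a.
  by move=> ay yb; rewrite FE.
rewrite !PhiE ?(ltW at_) ?(ltW tb)// opprB subrKA.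
move=> /(ler_wpM2r (normr_ge0 (s - t))); rewrite -normrM mulrBl.
by rewrite -[_^-1 *: _]/(_^-1 * _) mulrAC mulVf// mul1r distrC.
Qed.

(** * 1-Lipschitz functions *)

(** Take the distance to the lattice of multiples of [2 * d]. Its slopes are 1 and -1, and a kink at
    [x] is symmetric, so increments from [x] keep their absolute value even there. *)
Lemma zigzag_exists (R : realType) (d : R) : 0 < d ->
  exists z : R -> R, [/\ forall x, 0 <= z x <= d,
    forall x y, `|z x - z y| <= `|x - y| &
    forall x, exists2 r, 0 < r &
      forall y, `|y - x| < r -> `|z y - z x| = `|y - x|].
Proof.
move=> d0; pose n x := Num.floor ((x + d) / (2 * d)).
pose D x (m : int) := x - 2 * d * m%:~R.
have d20 : 0 < 2 * d by rewrite mulr_gt0.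
have nP x : - d <= D x (n x) < d.
  have := floor_le ((x + d) / (2 * d)); have := floorD1_gt ((x + d) / (2 * d)).
  rewrite -/(n x) intrD ltr_pdivrMr// ler_pdivlMr// /D mulrDl mul1r.
  move=> ? ?; apply/andP; split; lra.
(* Any lattice point within [d] of [x] realises the distance, including the tie at a midpoint. *)
have zE x m : `|D x m| <= d -> `|D x (n x)| = `|D x m|.
  rewrite ler_norml => /andP[Dm1 Dm2]; have /andP[Dn1 Dn2] := nP x.
  have DB : D x m - D x (n x) = 2 * d * (n x - m)%:~R by rewrite /D intrB; ring.
  have [mn|nm|->//] := ltgtP m (n x).
    have nm1 : 1 <= (n x - m)%:~R :> R.
      by rewrite -[1]/(1%:~R) ler_int -lezD1 in mn *; lia.
    have : 2 * d <= 2 * d * (n x - m)%:~R by rewrite ler_peMr// ltW.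
    rewrite -DB => ?; have -> : D x m = d by lra.
    by have -> : D x (n x) = - d; [lra|rewrite normrN].
  have nm1 : (n x - m)%:~R <= - 1 :> R.
    by rewrite -[- 1]/((- 1)%:~R) ler_int; lia.
  have : 2 * d * (n x - m)%:~R <= - (2 * d).
    by rewrite -[leRHS]mulrN1 ler_wpM2l// ltW.
  by rewrite -DB => ?; lra.
have z_le x : `|D x (n x)| <= d.
  by have /andP[? ?] := nP x; rewrite ler_norml; apply/andP; split; lra.
have z_min x m : `|D x (n x)| <= `|D x m|.
  by have [/zE->//|/ltW] := leP `|D x m| d; exact: le_trans.
exists (fun x => `|D x (n x)|); split.
- by move=> x; rewrite normr_ge0 z_le.
- have half x y : `|D x (n x)| - `|D y (n y)| <= `|x - y|.
    rewrite lerBlDr (le_trans (z_min x (n y)))//.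
    have -> : D x (n y) = (x - y) + D y (n y) by rewrite /D; ring.
    exact: ler_normD.
  by move=> x y; rewrite /= ler_norml half lerNl opprB (distrC x y) half.
move=> x; have /andP[Dx1 Dx2] := nP x.
have DE y m : D y m = D x m + (y - x) by rewrite /D; ring.
(* At a peak, the nearest lattice point is [n x] to the right and [n x - 1] to the left. *)
have [Dxd|Dxd] := eqVneq (D x (n x)) (- d).
  exists d => // y; rewrite ltr_norml => /andP[yx1 yx2].
  rewrite Dxd normrN (gtr0_norm d0).
  have [xy|yx] := leP x y.
    rewrite (zE y (n x)); last by rewrite DE Dxd ler_norml; apply/andP; split; lra.
    rewrite DE Dxd (@ler0_norm _ (- d + (y - x))); last by lra.
    by rewrite -normrN; congr `|_|; ring.
  have Dy : D y (n x - 1) = d + (y - x).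
    have DB : D x (n x - 1) = D x (n x) + 2 * d by rewrite /D intrB; ring.
    by rewrite DE DB Dxd; ring.
  rewrite (zE y (n x - 1)); last by rewrite Dy ler_norml; apply/andP; split; lra.
  by rewrite Dy (@ger0_norm _ (d + (y - x))); [congr `|_|; ring|lra].
(* At a valley, [x] is itself a lattice point. *)
have [Dx0|Dx0] := eqVneq (D x (n x)) 0.
  exists d => // y yx; have Dy : D y (n x) = y - x by rewrite DE Dx0 add0r.
  by rewrite (zE y (n x)) ?Dy ?Dx0 ?normr0 ?subr0 ?normr_id// ltW.
have Dxd' : `|D x (n x)| < d.
  by rewrite ltr_norml lt_neqAle eq_sym Dxd Dx1.
(* Away from the kinks, this radius keeps [y] on the monotone branch of [x]. *)
exists (Num.min `|D x (n x)| (d - `|D x (n x)|)).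
  by rewrite lt_min normr_gt0 Dx0 subr_gt0.
move=> y; rewrite lt_min => /andP[yx1 yx2].
rewrite (zE y (n x)); last first.
  by rewrite DE (le_trans (ler_normD _ _))//; lra.
rewrite DE; have [Dp|Dn|/eqP] := ltgtP 0 (D x (n x)).
- move: yx1; rewrite (gtr0_norm Dp) ltr_norml => /andP[? ?].
  by rewrite (@gtr0_norm _ (D x (n x) + (y - x))) ?(gtr0_norm Dp);
    [congr `|_|; ring|lra].
- move: yx1; rewrite (ltr0_norm Dn) ltr_norml => /andP[? ?].
  by rewrite (@ltr0_norm _ (D x (n x) + (y - x))) ?(ltr0_norm Dn);
    [rewrite -normrN; congr `|_|; ring|lra].
- by rewrite eq_sym (negbTE Dx0).
Qed.

Definition nonexpansive (R : realType) (X : metricType R) (h : X -> R) : Prop :=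
  forall x y, `|h x - h y| <= mdist x y.

(** McShane's extension: the infimum over [y] in [A] of the cones [h y + mdist x y]. *)
Lemma nonexpansive_extension (R : realType) (X : metricType R) (A : set X)
    (h : X -> R) : A !=set0 ->
  (forall x y, A x -> A y -> `|h x - h y| <= mdist x y) ->
  exists2 k : X -> R, nonexpansive k & forall x, A x -> k x = h x.
Proof.
move=> [x0 Ax0] hA.
pose S x := [set h y + mdist x y | y in A].
have S0 x : S x !=set0 by exists (h x0 + mdist x x0), x0.
have hS x : has_lbound (S x).
  exists (h x0 - mdist x x0) => _ [y Ay <-].
  have := hA _ _ Ax0 Ay; rewrite ler_norml => /andP[_ ?].
  have := metric_triangle x0 x y; rewrite (metric_sym x0 x) => ?; lra.
exists (fun x => inf (S x)).
  have half x y : inf (S x) - inf (S y) <= mdist x y.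
    rewrite lerBlDl -lerBlDr; apply: lb_le_inf => // _ [z Az <-].
    have : inf (S x) <= h z + mdist x z by apply: ge_inf => //; exists z.
    by have := metric_triangle x y z => ? ?; lra.
  by move=> x y; rewrite /= ler_norml half lerNl opprB (metric_sym x y) half.
move=> x Ax; apply/eqP; rewrite eq_le; apply/andP; split.
  by apply: ge_inf => //; exists x => //; rewrite mdistxx addr0.
apply: lb_le_inf => // _ [y Ay <-].
by have := hA _ _ Ax Ay; rewrite ler_norml => /andP[_ ?]; lra.
Qed.

Lemma nonexpansive_continuous (R : realType) (X : metricType R) (h : X -> R) :
  nonexpansive h -> continuous h.
Proof.
move=> hX x; apply/cvgrPdist_lt => e e0.
have : nbhs x (ball x e) by exact: nbhsx_ballx.
apply: filterS => y; rewrite ballEmdist/=; exact: le_lt_trans.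
Qed.

Lemma nonexpansive_mdist (R : realType) (X : metricType R) (x : X) :
  nonexpansive (mdist x).
Proof.
move=> y z; have := metric_triangle x y z; have := metric_triangle x z y.
by rewrite (metric_sym z y) ler_norml => ? ?; apply/andP; split; lra.
Qed.

(** The distance to [B], realised at a nearest point [p x], is nonexpansive in [x], hence attains
    its minimum on [A], which is positive by disjointness. *)
Lemma compact_mdist_ge (R : realType) (X : metricType R) (A B : set X) :
  compact A -> compact B -> (forall x y, A x -> B y -> x != y) ->
  exists2 d : R, 0 < d & forall x y, A x -> B y -> d <= mdist x y.
Proof.
move=> cA cB AB.
have [->|/set0P A0] := eqVneq A set0; first by exists 1.
have [->|/set0P B0] := eqVneq B set0; first by exists 1.
have /choice[p pP] x : exists y, B y /\ forall z, B z -> mdist x y <= mdist x z.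
  have [|y /set_mem By yB] := compact_EVT_min (f := mdist x) B0 cB.
    apply: continuous_subspaceT; apply: nonexpansive_continuous.
    exact: nonexpansive_mdist.
  by exists y; split => // z Bz; apply: yB; exact: mem_set.
have pX : nonexpansive (fun x => mdist x (p x)).
  have half x y : mdist x (p x) - mdist y (p y) <= mdist x y.
    rewrite lerBlDr (le_trans ((pP x).2 _ (pP y).1))//.
    exact: metric_triangle.
  by move=> x y; rewrite /= ler_norml half lerNl opprB (metric_sym x y) half.
have [|x /set_mem Ax xA] := compact_EVT_min (f := fun x => mdist x (p x)) A0 cA.
  by apply: continuous_subspaceT; exact: nonexpansive_continuous.
exists (mdist x (p x)); first by rewrite mdist_gt0; apply: AB => //; exact: (pP x).1.
move=> y z Ay Bz; apply: le_trans (xA y _) _; first exact: mem_set.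
exact: (pP y).2.
Qed.

(** * Slopes of curves at coinciding points *)

(** Along points of [K] tending to [t], the difference quotients of [F] and [H] have equal absolute
    values, so their limits do too. *)
Lemma slope_le_of_increments_eq (R : realType) (K : set R) (F H : R -> R)
    (t l m : R) :
  slope_at F t l -> slope_at H t m ->
  (forall r, 0 < r -> exists s, [/\ K s, s != t & `|s - t| < r]) ->
  (exists2 r, 0 < r &
    forall s, K s -> `|s - t| < r -> `|H s - H t| = `|F s - F t|) ->
  `|l| <= `|m|.
Proof.
move=> Fl Hm limK [r0 r00 HF]; apply/ler_addgt0Pr => e e0.
have e20 : 0 < e / 2 by rewrite divr_gt0.
have [r1 r10 Fr1] := Fl _ e20; have [r2 r20 Hr2] := Hm _ e20.
have [|s [Ks st]] := limK (Num.min r0 (Num.min r1 r2)).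
  by rewrite !lt_min r00 r10 r20.
rewrite !lt_min => /and3P[/(HF _ Ks) HFs /Fr1 Fs /Hr2 Hs].
have st0 : 0 < `|s - t| by rewrite normr_gt0 subr_eq0.
rewrite -(ler_pM2r st0) mulrDl -!normrM.
have := ler_normB (F s - F t) (F s - F t - l * (s - t)).
rewrite opprB addrC subrK => ls.
have := ler_normD (H s - H t - m * (s - t)) (m * (s - t)).
by rewrite subrK => ms; lra.
Qed.

(** For another coincidence, with [x = t' - t] and [y = s' - s], both [p1 * x - q1 * y] and
    [p2 * x - q2 * y] are small compared with [|x| + |y|]. The determinant being nonzero, Cramer's
    rule forces [x = y = 0]. *)
Lemma transversal_isolated (R : realType) (F1 F2 : R -> R)
    (t s p1 p2 q1 q2 : R) :
  slope_at F1 t p1 -> slope_at F2 t p2 -> slope_at F1 s q1 -> slope_at F2 s q2 ->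
  p1 * q2 != p2 * q1 -> F1 t = F1 s -> F2 t = F2 s ->
  exists2 r, 0 < r & forall t' s', `|t' - t| < r -> `|s' - s| < r ->
    F1 t' = F1 s' -> F2 t' = F2 s' -> t' = t.
Proof.
move=> F1t F2t F1s F2s pq F1ts F2ts.
pose M := `|p1| + `|p2| + `|q1| + `|q2| + 1.
pose D := `|p1 * q2 - p2 * q1|.
have D0 : 0 < D by rewrite normr_gt0 subr_eq0.
have M0 : 0 < M by rewrite ltr_wpDl ?ltr01// !addr_ge0.
(* Here [2 * M * e = D / 4], so Cramer's rule bounds each of [|x|] and [|y|] by a quarter of
   [|x| + |y|]. *)
pose e := D / (8 * M).
have e0 : 0 < e by rewrite divr_gt0// mulr_gt0.
have [r1 r10 F1tr] := F1t _ e0; have [r2 r20 F2tr] := F2t _ e0.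
have [r3 r30 F1sr] := F1s _ e0; have [r4 r40 F2sr] := F2s _ e0.
exists (Num.min (Num.min r1 r2) (Num.min r3 r4)).
  by rewrite !lt_min r10 r20 r30 r40.
move=> t' s'; rewrite !lt_min => /andP[/andP[tr1 tr2] _].
move=> /andP[_ /andP[sr3 sr4]] F1ts' F2ts'.
have {tr1}F1t' := F1tr _ tr1; have {tr2}F2t' := F2tr _ tr2.
have {sr3}F1s' := F1sr _ sr3; have {sr4}F2s' := F2sr _ sr4.
set x := t' - t in F1t' F2t'; set y := s' - s in F1s' F2s'.
have lin (p q u v w z : R) : `|u - w - p * x| <= e * `|x| ->
    `|v - z - q * y| <= e * `|y| -> u = v -> w = z ->
    `|p * x - q * y| <= e * (`|x| + `|y|).
  move=> ux vy uv wz; have -> : p * x - q * y =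
      (v - z - q * y) - (u - w - p * x) by rewrite uv wz; ring.
  rewrite [e * _]mulrDr (addrC (e * `|x|)); apply: le_trans (ler_normB _ _) _.
  exact: lerD.
have H1 := lin _ _ _ _ _ _ F1t' F1s' F1ts' F1ts.
have H2 := lin _ _ _ _ _ _ F2t' F2s' F2ts' F2ts.
have cramer (c1 c2 w : R) : `|c1| <= M -> `|c2| <= M ->
    (p1 * q2 - p2 * q1) * w =
      c1 * (p1 * x - q1 * y) - c2 * (p2 * x - q2 * y) ->
    D * `|w| <= M * (e * (`|x| + `|y|)) *+ 2.
  move=> c1M c2M; rewrite /D -normrM => ->.
  rewrite (le_trans (ler_normB _ _))// mulr2n !normrM.
  by apply: lerD; apply: ler_pM.
have nM : [/\ `|p1| <= M, `|p2| <= M, `|q1| <= M & `|q2| <= M].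
  have := normr_ge0 p1; have := normr_ge0 p2.
  have := normr_ge0 q1; have := normr_ge0 q2.
  by rewrite /M => ? ? ? ?; split; lra.
case: nM => p1M p2M q1M q2M.
have Hx : D * `|x| <= M * (e * (`|x| + `|y|)) *+ 2.
  by apply: (cramer q2 q1) => //; ring.
have Hy : D * `|y| <= M * (e * (`|x| + `|y|)) *+ 2.
  by apply: (cramer p2 p1) => //; ring.
have Me : M * (e * (`|x| + `|y|)) *+ 2 = D * ((`|x| + `|y|) / 4).
  by rewrite /e; field; rewrite gt_eqF.
move: Hx Hy; rewrite Me !ler_pM2l// => Hx Hy.
have x0 := normr_ge0 x; have y0 := normr_ge0 y.
have : `|x| = 0 by lra.
by move/normr0_eq0/eqP; rewrite subr_eq0 => /eqP.
Qed.

(** Attach to [t] a rational box around [(t, s)] of radius below [r / 2]. Two pairs in the same box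
    lie within the isolation radius of each other, so the box determines [t]. *)
Lemma countable_isolated_coincidence (R : realType) (C : R -> R -> Prop)
    (T : set R) :
  (forall t, T t -> exists2 s, C t s & exists2 r, 0 < r &
    forall t' s', `|t' - t| < r -> `|s' - s| < r -> C t' s' -> t' = t) ->
  countable T.
Proof.
move=> TC.
pose Q t (c : rat * rat * rat) := exists s : R,
  [/\ `|t - ratr c.1.1| < ratr c.2, `|s - ratr c.1.2| < ratr c.2, C t s &
   forall t' s', `|t' - t| < ratr c.2 *+ 2 -> `|s' - s| < ratr c.2 *+ 2 ->
    C t' s' -> t' = t].
have /choice[f fQ] : forall t, exists c, T t -> Q t c.
  move=> t; have [/TC[s Cts [r r0 rP]]|nT] := pselect (T t); last by exists (0, 0, 0).
  have near_rat (x e : R) : 0 < e -> exists q : rat, `|x - ratr q| < e.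
    move=> e0; have xe : x - e < x + e by lra.
    have [q] := rat_in_itvoo xe; rewrite in_itv/= => /andP[? ?].
    by exists q; rewrite ltr_norml; apply/andP; split; lra.
  have r20 : 0 < r / 2 by rewrite divr_gt0.
  have [e] := rat_in_itvoo r20; rewrite in_itv/= => /andP[e0 er].
  have [p tp] := near_rat t _ e0; have [q sq] := near_rat s _ e0.
  exists (p, q, e) => _; exists s; split => //= t' s' tt' ss'; apply: rP.
    by apply: lt_le_trans tt' _; rewrite mulr2n; lra.
  by apply: lt_le_trans ss' _; rewrite mulr2n; lra.
apply/countable_injP; exists (pickle \o f) => t t' /set_mem Tt /set_mem Tt'.
move=> /= /(pcan_inj pickleK) ff'.
have [s [tp sq _ uniq_t]] := fQ _ Tt.
have [s' [tp' sq' Cts' _]] := fQ _ Tt'; rewrite -ff' in tp' sq'.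
apply/esym; apply: uniq_t Cts'.
  have -> : t' - t = (t' - ratr (f t).1.1) - (t - ratr (f t).1.1) by ring.
  by rewrite (le_lt_trans (ler_normB _ _))// mulr2n ltrD.
have -> : s' - s = (s' - ratr (f t).1.2) - (s - ratr (f t).1.2) by ring.
by rewrite (le_lt_trans (ler_normB _ _))// mulr2n ltrD.
Qed.

(** * Exceptional null sets *)

Lemma countable_ae (R : realType) (A : set R) : countable A ->
  {ae (@lebesgue_measure R), forall t, ~ A t}.
Proof.
move=> cA; exists A; split.
- by apply: countable_measurable => // t; exact: measurable_set1.
- exact: countable_lebesgue_measure0.
- by move=> t /= /contrapT.
Qed.

(** Only isolated points of [K] fail. They are countable by the previous criterion, for the relation
    [K t] constant in its second argument. *)
Lemma ae_limit_point (R : realType) (K : set R) :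
  {ae (@lebesgue_measure R), forall t, K t ->
    forall r, 0 < r -> exists s, [/\ K s, s != t & `|s - t| < r]}.
Proof.
pose T := [set t | K t /\ exists2 r, 0 < r &
  forall s, K s -> `|s - t| < r -> s = t].
have cT : countable T.
  apply: (@countable_isolated_coincidence _ (fun t _ => K t)).
  move=> t [Kt [r r0 rK]]; exists 0 => //; exists r => // t' s' tt' _ Kt'.
  exact: rK.
have := countable_ae cT.
apply: filterS; first exact: (ae_filter_ringOfSetsType (@lebesgue_measure R)).
move=> t nT Kt r r0; apply: contrapT => nex; apply: nT; split => //.
exists r => // s Ks st; apply: contrapT => /eqP sNt; apply: nex.
by exists s.
Qed.

Lemma lebesgue_ae_impl (R : realType) (P Q : R -> Prop) :
  (forall t, P t -> Q t) -> {ae (@lebesgue_measure R), forall t, P t} ->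
  {ae (@lebesgue_measure R), forall t, Q t}.
Proof.
move=> PQ [N [mN N0 PN]]; exists N; split => // t nQt.
by apply: PN => /= Pt; apply: nQt; exact: PQ.
Qed.

Lemma lebesgue_ae_and (R : realType) (P Q : R -> Prop) :
  {ae (@lebesgue_measure R), forall t, P t} ->
  {ae (@lebesgue_measure R), forall t, Q t} ->
  {ae (@lebesgue_measure R), forall t, P t /\ Q t}.
Proof.
move=> aeP aeQ; have [N [mN N0 sN]] := negligibleU aeP aeQ.
by exists N; split => // t /not_andP PQ; exact: sN.
Qed.

Lemma slope_at_near (R : realType) (F : R -> R) (t l : R) :
  slope_at F t l -> forall e, 0 < e ->
  exists2 r : R, 0 < r & forall s, `|s - t| < r -> `|F s - F t| < e.
Proof.
move=> Fl e e0; have [r r0 rF] := Fl _ ltr01.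
have l0 : 0 < `|l| + 1 by rewrite ltr_wpDl.
exists (Num.min r (e / (`|l| + 1))); first by rewrite lt_min r0 divr_gt0.
move=> s; rewrite lt_min => /andP[/rF sF]; rewrite ltr_pdivlMr// => se.
have := ler_normD (F s - F t - l * (s - t)) (l * (s - t)).
by rewrite subrK normrM => ?; lra.
Qed.

(** * One function dominating finitely many densities *)

(** Up to measure [e] and times where both densities vanish, the times where [|G f1|] or [|G f2|]
    dominates fill compact sets [K1] and [K2] whose images are some [d > 0] apart. Zigzags of height
    [d] can be glued across this gap and preserve the absolute slopes. *)
Lemma nonexpansive_density_max (R : realType) (X : metricType R) (a b : R)
    (gamma : R -> X) (G : (X -> R) -> R -> R) :
  {within `[a, b], continuous gamma} ->
  (forall h, nonexpansive h -> has_density a b (h \o gamma) (G h)) ->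
  forall (f1 f2 : X -> R) (e : R), nonexpansive f1 -> nonexpansive f2 -> 0 < e ->
  exists h (E : set (measurableTypeR R)), [/\ nonexpansive h, measurable E,
    (lebesgue_measure E <= e%:E)%E &
    {ae (@lebesgue_measure R), forall t, a < t -> t < b -> ~ E t ->
      `|G f1 t| <= `|G h t| /\ `|G f2 t| <= `|G h t|}].
Proof.
move=> cgamma HG f1 f2 e nf1 nf2 e0.
have mabs f : nonexpansive f -> measurable_fun setT (fun t => `|G f t|).
  move=> /HG[+ _] => /integrableP[/measurable_EFinP mf _].
  exact: measurableT_comp.
have slopes f : nonexpansive f -> {ae (@lebesgue_measure R), forall t,
    a < t -> t < b -> slope_at (f \o gamma) t (G f t)}.
  by move=> /HG; exact: has_density_slope.
have [N1 [mN1 N10 slope1]] := slopes _ nf1.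
have [N2 [mN2 N20 slope2]] := slopes _ nf2.
pose g1 := G f1; pose g2 := G f2.
pose B0 := `]a, b[ `\` (N1 `|` N2).
have B0P t : B0 t -> [/\ a < t, t < b, slope_at (f1 \o gamma) t (g1 t) &
    slope_at (f2 \o gamma) t (g2 t)].
  move=> [/=]; rewrite in_itv/= => /andP[at_ tb] /not_orP[nN1 nN2]; split => //.
    by apply: contrapT => ns; apply: nN1; apply: slope1 => /(_ at_ tb).
  by apply: contrapT => ns; apply: nN2; apply: slope2 => /(_ at_ tb).
have mB0 : measurable (B0 : set (measurableTypeR R)).
  by apply: measurableD => //; exact: measurableU.
pose L := [set t | `|g2 t| <= `|g1 t|].
pose Z := [set t | `|g1 t| <= 0].
(* Removing [Z] gives [|g1| > 0] on [B1], while [|g2| > |g1|] on [B2]; both strict inequalities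
   serve for transversality. *)
pose B1 := (B0 `&` L) `\` Z.
pose B2 := B0 `\` L.
have m1 := mabs _ nf1; have m2 := mabs _ nf2.
have mL : measurable (L : set (measurableTypeR R)).
  by rewrite -[X in measurable X]setTI; exact: measurable_fun_le.
have mZ : measurable (Z : set (measurableTypeR R)).
  by rewrite -[X in measurable X]setTI; exact: measurable_fun_le.
have mB1 : measurable (B1 : set (measurableTypeR R)).
  by apply: measurableD => //; exact: measurableI.
have mB2 : measurable (B2 : set (measurableTypeR R)) by exact: measurableD.
pose T := [set t | B1 t /\ exists2 s, B2 s & gamma t = gamma s].
have cT : countable T.
  apply: (@countable_isolated_coincidence _ (fun t s => gamma t = gamma s)).
  move=> t [[[/B0P[_ _ f1t f2t] g21] /negP]]; rewrite -ltNge => g1t.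
  move=> [s [/B0P[_ _ f1s f2s] /negP]]; rewrite -ltNge => g12 ts.
  exists s => //.
  have [|||r r0 rP] := transversal_isolated f1t f2t f1s f2s.
  (* The determinant is nonzero since [|g2 t| * |g1 s| <= |g1 t| * |g1 s| < |g1 t| * |g2 s|]. *)
  - apply/eqP => /(congr1 Num.norm); rewrite !normrM => /eqP.
    rewrite gt_eqF// (@le_lt_trans _ _ (`|g1 t| * `|g1 s|))//.
      exact: ler_wpM2r.
    by rewrite ltr_pM2l.
  - by rewrite /= ts.
  - by rewrite /= ts.
  by exists r => // t' s' tt' ss' ts'; apply: (rP t' s') => //=; rewrite ts'.
have mT : measurable (T : set (measurableTypeR R)).
  by apply: countable_measurable => // t; exact: measurable_set1.
have e20 : 0 < e / 2 by rewrite divr_gt0.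
have finB (B : set (measurableTypeR R)) : measurable B -> B `<=` B0 ->
    (lebesgue_measure B < +oo)%E.
  move=> mB BB0; apply: (@le_lt_trans _ _ (lebesgue_measure `]a, b[%classic)).
    by apply: le_measure; rewrite ?inE// => t /BB0[].
  by rewrite lebesgue_measure_itv/=; case: ifP => _; rewrite ?ltry// -EFinB ltry.
have mB1T : measurable (B1 `\` T : set (measurableTypeR R)) by exact: measurableD.
(* Inner regularity is applied after deleting the countable [T], so that the images of [K1] and [K2]
   are disjoint. *)
have [K1 [cK1 K1B K1e]] : exists V, [/\ compact V, V `<=` B1 `\` T &
    (lebesgue_measure ((B1 `\` T) `\` V) < (e / 2)%:E)%E].
  by apply: lebesgue_regularity_inner => //; apply: finB => // t [[[]]].
have [K2 [cK2 K2B K2e]] : exists V, [/\ compact V, V `<=` B2 &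
    (lebesgue_measure (B2 `\` V) < (e / 2)%:E)%E].
  by apply: lebesgue_regularity_inner => //; apply: finB => // t [].
have image_compact K : compact K -> K `<=` B0 -> compact (gamma @` K).
  move=> cK KB; apply: continuous_compact => //.
  apply: continuous_subspaceW cgamma => t /KB[/= + _].
  by rewrite !in_itv/= => /andP[/ltW -> /ltW ->].
have cgK1 : compact (gamma @` K1) by apply: image_compact => // t /K1B[[[]]].
have cgK2 : compact (gamma @` K2) by apply: image_compact => // t /K2B[].
have [d d0 dK] : exists2 d : R, 0 < d & forall x y,
    (gamma @` K1) x -> (gamma @` K2) y -> d <= mdist x y.
  apply: compact_mdist_ge => // _ _ [t /K1B[B1t nTt] <-] [s /K2B B2s <-].
  by apply/eqP => ts; apply: nTt; split => //; exists s.
have [z [z0d zle zloc]] := zigzag_exists d0.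
(* Zigzag values lie in [[0, d]] and the images are at least [d] apart, so the two pieces together
   are nonexpansive on the union of the images. *)
pose h0 x := if x \in gamma @` K1 then z (f1 x) else z (f2 x).
have h0K1 t : K1 t -> h0 (gamma t) = z (f1 (gamma t)).
  by move=> K1t; rewrite /h0 mem_set//; exists t.
have h0K2 t : K2 t -> h0 (gamma t) = z (f2 (gamma t)).
  move=> K2t; rewrite /h0 memNset// => K1t.
  have : (gamma @` K2) (gamma t) by exists t.
  by move=> /(dK _ _ K1t); rewrite mdistxx leNgt d0.
have [h nh [hK1 hK2]] : exists2 h, nonexpansive h &
    (forall t, K1 t -> h (gamma t) = z (f1 (gamma t))) /\
    (forall t, K2 t -> h (gamma t) = z (f2 (gamma t))).
  have [K0|/set0P K0] := eqVneq (gamma @` K1 `|` gamma @` K2) set0.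
    exists f1 => //; split=> t Kt.
      have : set0 (gamma t) by rewrite -K0; left; exists t.
      by [].
    have : set0 (gamma t) by rewrite -K0; right; exists t.
    by [].
  have zz u v : `|z u - z v| <= d.
    have /andP[? ?] := z0d u; have /andP[? ?] := z0d v.
    by rewrite ler_norml; apply/andP; split; lra.
  have [|h nh hE] := nonexpansive_extension (h := h0) K0.
    move=> _ _ [[t Kt <-]|[t Kt <-]] [[s Ks <-]|[s Ks <-]].
    - by rewrite !h0K1//; apply: le_trans (zle _ _) _; exact: nf1.
    - rewrite h0K1// h0K2//; apply: le_trans (zz _ _) _.
      by apply: dK; [exists t|exists s].
    - rewrite h0K2// h0K1// metric_sym; apply: le_trans (zz _ _) _.
      by apply: dK; [exists s|exists t].
    - by rewrite !h0K2//; apply: le_trans (zle _ _) _; exact: nf2.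
  exists h => //; split=> t Kt; first by rewrite hE ?h0K1//; left; exists t.
  by rewrite hE ?h0K2//; right; exists t.
exists h, (((B1 `\` T) `\` K1) `|` (B2 `\` K2)); split => //.
- apply: measurableU; apply: measurableD => //; exact: compact_measurable.
- rewrite (splitr e) EFinD; apply: le_trans (measureU2 _ _ _) _.
  + by apply: measurableD => //; exact: compact_measurable.
  + by apply: measurableD => //; exact: compact_measurable.
  by apply: leeD; exact: ltW.
have ae12 : {ae (@lebesgue_measure R), forall t, ~ (N1 `|` N2) t}.
  have n1 : (@lebesgue_measure R).-negligible N1.
    by exists N1; split; [exact: mN1|exact: N10|].
  have n2 : (@lebesgue_measure R).-negligible N2.
    by exists N2; split; [exact: mN2|exact: N20|].
  have [N [mN N0 sN]] := negligibleU n1 n2.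
  by exists N; split => // t /= /contrapT; exact: sN.
have := lebesgue_ae_and ae12 (lebesgue_ae_and (countable_ae cT)
  (lebesgue_ae_and (slopes _ nh)
    (lebesgue_ae_and (ae_limit_point K1) (ae_limit_point K2)))).
apply: lebesgue_ae_impl.
move=> t [n12 [nT [slopeh [lim1 lim2]]]] at_ tb nE.
have B0t : B0 t by split => //=; rewrite in_itv/= at_.
have [_ _ s1 s2] := B0P _ B0t.
(* The zigzag preserves absolute increments near [f (gamma t)], so along [K] those of [h \o gamma]
   and [f \o gamma] agree. *)
have key f (K : set R) : slope_at (f \o gamma) t (G f t) ->
    (forall r, 0 < r -> exists s, [/\ K s, s != t & `|s - t| < r]) ->
    K t -> (forall s, K s -> h (gamma s) = z (f (gamma s))) ->
    `|G f t| <= `|G h t|.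
  move=> sf limK Kt hK.
  apply: (slope_le_of_increments_eq sf (slopeh at_ tb) limK).
  have [r r0 rz] := zloc (f (gamma t)).
  have [r' r'0 r'f] := slope_at_near sf r0.
  by exists r' => // s Ks st; rewrite /= !hK// rz//; exact: r'f.
have [Lt|nLt] := pselect (L t).
  (* On [L] and [Z] together both densities vanish, so any [h] dominates them. *)
  have [Zt|nZt] := pselect (Z t).
    split; first exact: le_trans Zt _.
    by apply: (le_trans Lt); apply: (le_trans Zt).
  have B1t : B1 t by [].
  have K1t : K1 t by apply: contrapT => nK1; apply: nE; left.
  have k1 := key _ _ s1 (lim1 K1t) K1t hK1.
  by split => //; exact: le_trans k1.
have B2t : B2 t by [].
have K2t : K2 t by apply: contrapT => nK2; apply: nE; right.
have k2 := key _ _ s2 (lim2 K2t) K2t hK2.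
split => //; apply: le_trans k2; apply/ltW.
by move/negP : nLt; rewrite -ltNge.
Qed.

(** Induction on [n]: half of the exceptional measure is spent on the earlier functions, half on
    merging in the next one. *)
Lemma nonexpansive_density_bigmax (R : realType) (X : metricType R) (a b : R)
    (gamma : R -> X) (G : (X -> R) -> R -> R) :
  {within `[a, b], continuous gamma} ->
  (forall h, nonexpansive h -> has_density a b (h \o gamma) (G h)) ->
  forall n (f : nat -> X -> R) (e : R), (forall i, nonexpansive (f i)) -> 0 < e ->
  exists h (E : set (measurableTypeR R)), [/\ nonexpansive h, measurable E,
    (lebesgue_measure E <= e%:E)%E &
    {ae (@lebesgue_measure R), forall t, a < t -> t < b -> ~ E t ->
      forall i, (i <= n)%N -> `|G (f i) t| <= `|G h t|}].
Proof.
move=> cgamma HG; elim=> [|n IH] f e nf e0.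
  exists (f 0), set0; split => //; first by rewrite measure0 lee_fin ltW.
  by apply: aeW => t _ _ _ i; rewrite leqn0 => /eqP ->.
have e20 : 0 < e / 2 by rewrite divr_gt0.
have [h1 [E1 [nh1 mE1 E1e H1]]] := IH f _ nf e20.
have [h [E2 [nh mE2 E2e H2]]] :=
  nonexpansive_density_max cgamma HG nh1 (nf n.+1) e20.
exists h, (E1 `|` E2); split => //; first exact: measurableU.
  by rewrite (splitr e) EFinD (le_trans (measureU2 _ _ _))// leeD.
apply: lebesgue_ae_impl (lebesgue_ae_and H1 H2) => t [{}H1 {}H2] at_ tb.
move=> /not_orP[nE1 nE2] i; have [h1h fh] := H2 at_ tb nE2.
rewrite leq_eqVlt ltnS => /predU1P[->//|?].
by apply: le_trans h1h; exact: H1.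
Qed.

(** * Uniform boundedness of the variation *)

Lemma variation_scale (R : realType) (a b c : R) (f : R -> R) (s : seq R) :
  variation a b (fun t => c * f t) s = `|c| * variation a b f s.
Proof.
rewrite /variation mulr_sumr; apply: eq_bigr => i _ /=.
by rewrite -mulrBr normrM.
Qed.

Lemma variation_addr_const (R : realType) (a b c : R) (f : R -> R) (s : seq R) :
  variation a b (fun t => f t + c) s = variation a b f s.
Proof.
rewrite /variation; apply: eq_bigr => i _ /=.
by congr `|_|; ring.
Qed.

Lemma exprn_small (R : realType) (z c e : R) : 0 <= z < 1 -> 0 < e ->
  exists n, z ^+ n * c < e.
Proof.
move=> /andP[z0 z1] e0; have c0 : 0 < `|c| + 1 by rewrite ltr_wpDl.
have : `|z| < 1 by rewrite ger0_norm.
move=> /cvg_expr/cvgrPdist_lt/(_ _ (divr_gt0 e0 c0))[n _ /(_ n (leqnn n))].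
rewrite /= sub0r normrN ger0_norm ?exprn_ge0// ltr_pdivlMr// => ze.
exists n; apply: le_lt_trans ze; apply: ler_wpM2l; first exact: exprn_ge0.
by rewrite (le_trans (ler_norm c))// lerDl.
Qed.

(* Sokal's gliding hump: [sum_i +- 3^-i h_i], the i-th sign being chosen so that
   the i-th term does not decrease the variation along the i-th partition. *)
Lemma nonexpansive_uniform_total_variation (R : realType) (X : metricType R)
    (a b : R) (gamma : R -> X) : a <= b ->
  (forall h, nonexpansive h ->
    total_variation a b (h \o gamma) \is a fin_num) ->
  exists C : R, forall h, nonexpansive h ->
    (total_variation a b (h \o gamma) <= C%:E)%E.
Proof.
move=> ab TVfin; apply: contrapT => unbounded.
pose T s (h : X -> R) := variation a b (h \o gamma) s.
have TZ s c h : T s (fun x => c * h x) = `|c| * T s h by exact: variation_scale.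
have T0 s h : 0 <= T s h by exact: variation_ge0.
(* On a fixed partition the variations of nonexpansive functions are bounded, so the supremum taken
   in [large] is finite. *)
have T_lip s h (c : R) : 0 <= c ->
    (forall x y, `|h x - h y| <= c * mdist x y) ->
    T s h <= c * \sum_(0 <= n < size s)
      mdist (gamma (nth b s n)) (gamma (nth b (a :: s) n)).
  by move=> c0 hc; rewrite mulr_sumr; apply: ler_sum => i _; exact: hc.
(* The function is nearly optimal for its partition: it reaches 3/4 of the supremum over
   nonexpansive functions, which exceeds [4 ^+ j]. Subtracting a constant makes it vanish at
   [gamma a]. *)
have large (j : nat) : exists sh : seq R * (X -> R),
    [/\ itv_partition a b sh.1, nonexpansive sh.2, sh.2 (gamma a) = 0,
        3 * 4 ^+ j <= 4 * T sh.1 sh.2 &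
        forall h, nonexpansive h -> 3 * T sh.1 h <= 4 * T sh.1 sh.2].
  have [h [nh hj]] : exists h, nonexpansive h /\
      ~ (total_variation a b (h \o gamma) <= (4 ^+ j)%:E)%E.
    apply: contrapT => nex; apply: unbounded; exists (4 ^+ j) => h nh.
    by apply: contrapT => nle; apply: nex; exists h.
  have [s sP hs] : exists2 s, itv_partition a b s & 4 ^+ j < T s h.
    apply: contrapT => nex; apply: hj; apply: ge_ereal_sup => _ [_ [s sP <-] <-].
    by rewrite lee_fin leNgt; apply/negP => lts; apply: nex; exists s.
  pose S := [set T s k | k in [set k | nonexpansive k]].
  have supS : has_sup S.
    split; first by exists (T s h), h.
    eexists => _ [k nk <-]; apply: (T_lip s k 1) => // x y.
    by rewrite mul1r; exact: nk.
  have hS : T s h <= sup S by apply: ub_le_sup; [exact: supS.2|exists h].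
  have S0 : 0 < sup S / 4.
    by rewrite divr_gt0// (lt_le_trans _ hS)// (lt_trans _ hs)// exprn_gt0.
  have [_ [k nk <-] kS] := sup_adherent S0 supS.
  have kE : T s (fun x => k x + - k (gamma a)) = T s k.
    exact: (variation_addr_const a b (- k (gamma a)) (k \o gamma) s).
  exists (s, fun x => k x + - k (gamma a)); split => //=.
  - by move=> x y /=; rewrite opprD addrACA subrr addr0; exact: nk.
  - by rewrite subrr.
  - by rewrite kE; lra.
  - move=> h' nh'; rewrite kE.
    have : T s h' <= sup S by apply: ub_le_sup; [exact: supS.2|exists h'].
    by lra.
have [w wP] := choice large.
pose s j := (w j).1; pose h j := (w j).2.
pose q : R := 3^-1.
pose step j (f : X -> R) : X -> R :=
  if q ^+ j * T (s j) (h j) <= T (s j) (fun x => f x + q ^+ j * h j x)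
  then fun x => f x + q ^+ j * h j x else fun x => f x - q ^+ j * h j x.
pose S := fix S j : X -> R := if j is j'.+1 then step j' (S j') else fun=> 0.
have q0 : 0 < q by rewrite invr_gt0.
have q01 : 0 <= q < 1 by rewrite (ltW q0) invf_lt1// ltr1n.
(* The two candidates differ by twice the new term, so if one has less variation than that term, the
   other has more. *)
have S_T j : q ^+ j * T (s j) (h j) <= T (s j) (S j.+1).
  rewrite /= /step; case: ifPn => //; rewrite -ltNge => lt.
  have : T (s j) (fun x => 2 * (q ^+ j * h j x)) <=
      T (s j) (fun x => S j x + q ^+ j * h j x) +
      T (s j) (fun x => S j x - q ^+ j * h j x).
    rewrite -[X in _ + X]variationN.
    apply: le_trans (variation_le _ _ _ _ _).
    rewrite le_eqVlt; apply/orP; left; apply/eqP.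
    by congr variation; apply/funext => t /=; ring.
  by rewrite !TZ !gtr0_norm ?exprn_gt0//; lra.
have S_inc j x y : `|(S j.+1 x - S j x) - (S j.+1 y - S j y)| <=
    q ^+ j * mdist x y.
  have [_ nh _ _ _] := wP j.
  have -> : `|(S j.+1 x - S j x) - (S j.+1 y - S j y)| =
      `|q ^+ j * (h j x - h j y)|.
    rewrite /= /step; case: ifPn => _; first by congr `|_|; ring.
    by rewrite -normrN; congr `|_|; ring.
  by rewrite normrM gtr0_norm ?exprn_gt0// ler_pM2l ?exprn_gt0//; exact: nh.
(* The constant [3 / 2 * q ^+ n] is the sum of the geometric tail starting at [q ^+ n]. *)
have S_dist n m x y : (n <= m)%N -> `|(S m x - S n x) - (S m y - S n y)| <=
    3 / 2 * q ^+ n * mdist x y.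
  move=> /subnKC <-; have D0 : 0 <= mdist x y := mdist_ge0 _ _.
  suff : `|(S (n + (m - n))%N x - S n x) - (S (n + (m - n))%N y - S n y)| <=
      3 / 2 * (q ^+ n - q ^+ (n + (m - n))%N) * mdist x y.
    move=> /le_trans; apply; apply: ler_wpM2r => //.
    by rewrite ler_pM2l// gerBl exprn_ge0// ltW.
  elim: (m - n)%N => [|k IH].
    by rewrite addn0 !subrr normr0 mulr0 mul0r.
  rewrite addnS; set p := (n + k)%N in IH *.
  have -> : (S p.+1 x - S n x) - (S p.+1 y - S n y) =
      ((S p.+1 x - S p x) - (S p.+1 y - S p y)) +
      ((S p x - S n x) - (S p y - S n y)) by ring.
  apply: le_trans (ler_normD _ _) _; apply: le_trans (lerD (S_inc _ _ _) IH) _.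
  rewrite exprS le_eqVlt; apply/orP; left; apply/eqP.
  by rewrite /q; field.
(* All [S n] vanish at [gamma a], so [S n x] is Cauchy with errors proportional to the distance of
   [x] from [gamma a]. The limit is the infimum of the upper bounds [u n]. *)
have [f fS] : exists f : X -> R, forall n x,
    `|S n x - f x| <= 3 / 2 * q ^+ n * mdist x (gamma a).
  suff H (x : X) : exists l, forall n,
      `|S n x - l| <= 3 / 2 * q ^+ n * mdist x (gamma a).
    by have [f fS] := choice H; exists f.
  pose D := mdist x (gamma a); pose u n := S n x + 3 / 2 * q ^+ n * D.
  have Sa j : S j (gamma a) = 0.
    elim: j => [//|j IH]; have [_ _ ha _ _] := wP j.
    by rewrite /= /step; case: ifPn => _; rewrite IH /h ha; ring.
  have D0 : 0 <= D := mdist_ge0 _ _.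
  have vu n m : S n x - 3 / 2 * q ^+ n * D <= u m.
    have qD k : 0 <= 3 / 2 * q ^+ k * D.
      by rewrite !mulr_ge0// exprn_ge0// ltW.
    have := qD n; have := qD m.
    have [nm|/ltnW mn] := leqP n m.
      have := S_dist _ _ x (gamma a) nm; rewrite !Sa -/D subrr subr0 ler_norml.
      by rewrite /u => /andP[? _] ? ?; lra.
    have := S_dist _ _ x (gamma a) mn; rewrite !Sa -/D subrr subr0 ler_norml.
    by rewrite /u => /andP[_ ?] ? ?; lra.
  have lbu n : lbound (range u) (S n x - 3 / 2 * q ^+ n * D).
    by move=> _ [m _ <-].
  exists (inf (range u)) => n; rewrite ler_norml.
  have : inf (range u) <= u n.
    by apply: ge_inf; [exists (S 0 x - 3 / 2 * q ^+ 0 * D)|exists n].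
  have : S n x - 3 / 2 * q ^+ n * D <= inf (range u).
    by apply: lb_le_inf; [exists (u 0), 0|exact: lbu].
  by rewrite /u -/D => ? ?; apply/andP; split; lra.
(* The bound [S_dist] passes to the limit by comparing [f] with [S k] for large [k]. *)
have f_tail n x y : `|(f x - S n x) - (f y - S n y)| <=
    3 / 2 * q ^+ n * mdist x y.
  apply/ler_addgt0Pr => e e0; pose D := mdist x (gamma a) + mdist y (gamma a).
  have [m qm] := exprn_small (3 / 2 * D) q01 e0.
  have [k nk qk] : exists2 k, (n <= k)%N & 3 / 2 * q ^+ k * D < e.
    exists (maxn n m); first exact: leq_maxl.
    apply: le_lt_trans qm.
    rewrite [leLHS](_ : _ = q ^+ maxn n m * (3 / 2 * D)); last by ring.
    apply: ler_wpM2r; first by rewrite mulr_ge0// addr_ge0// mdist_ge0.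
    by apply: ler_wiXn2l; rewrite ?leq_maxr// ltW//; have /andP[] := q01.
  have -> : (f x - S n x) - (f y - S n y) =
      ((S k x - S n x) - (S k y - S n y)) - ((S k x - f x) - (S k y - f y)).
    by ring.
  apply: le_trans (ler_normB _ _) _; apply: lerD; first exact: S_dist.
  apply: le_trans (ler_normB _ _) _; apply: le_trans (ltW qk).
  by rewrite /D mulrDr; apply: lerD; exact: fS.
have nonexp_scale (k : X -> R) c : 0 < c ->
    (forall x y, `|k x - k y| <= c * mdist x y) ->
    nonexpansive (fun x => c^-1 * k x).
  move=> c0 kc x y; rewrite -mulrBr normrM gtr0_norm ?invr_gt0//.
  by rewrite ler_pdivrMl.
(* The tail [f - S j.+1] has Lipschitz constant [q ^+ j / 2], so near-optimality of [h j] bounds its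
   variation by [2 / 3 * q ^+ j * T (s j) (h j)]. A third of the variation in [S_T] survives. *)
have Tf j : 3^-1 * q ^+ j * T (s j) (h j) <= T (s j) f.
  have c0 : 0 < 3 / 2 * q ^+ j.+1 by rewrite mulr_gt0// exprn_gt0.
  have := nonexp_scale _ _ c0 (f_tail j.+1).
  have [_ _ _ _ maxh] := wP j => /maxh; rewrite -/(s j) -/(h j) TZ.
  rewrite gtr0_norm ?invr_gt0// mulrCA ler_pdivrMl// => tail.
  have : T (s j) (S j.+1) <= T (s j) f + T (s j) (fun x => f x - S j.+1 x).
    rewrite -[X in _ + X]variationN.
    apply: le_trans (variation_le _ _ _ _ _).
    rewrite le_eqVlt; apply/orP; left; apply/eqP.
    by congr variation; apply/funext => t /=; ring.
  have := S_T j; move: tail; rewrite exprS /q => *; lra.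
have c0 : 0 < 3 / 2 :> R by [].
have f_lip x y : `|f x - f y| <= 3 / 2 * mdist x y.
  by have := f_tail 0 x y; rewrite /= !subr0 expr0 mulr1.
have nf := nonexp_scale _ _ c0 f_lip.
pose V := fine (total_variation a b ((fun x => (3 / 2)^-1 * f x) \o gamma)).
have TV j : T (s j) f <= 3 / 2 * V.
  have [sP _ _ _ _] := wP j.
  rewrite -ler_pdivrMl// -[(3 / 2)^-1]gtr0_norm// -TZ -lee_fin.
  rewrite /V fineK ?TVfin//.
  apply: ereal_sup_ubound.
  by exists (T (s j) (fun x => (3 / 2)^-1 * f x)) => //; exists (s j).
have q34 : 0 <= 3 / 4 :> R by [].
(* Together [Tf] and [TV] give [4^-1 * (4 / 3) ^+ j <= 3 / 2 * V] for every [j]; the chosen [j]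
   violates this. *)
have [|j] := @exprn_small _ (3 / 4) (6 * V) 1 _ ltr01; first by lra.
apply/negP; rewrite -leNgt.
have [_ _ _ big _] := wP j.
have : 3^-1 * q ^+ j * (3 / 4 * 4 ^+ j) <= 3 / 2 * V.
  apply: le_trans (TV j); apply: le_trans (Tf j).
  rewrite ler_pM2l ?mulr_gt0// ?exprn_gt0// -/(s j) -/(h j) in big *.
  by lra.
rewrite [X in X <= _](_ : _ = 4^-1 * (q * 4) ^+ j); last by rewrite exprMn; field.
have -> : q * 4 = (3 / 4)^-1 by rewrite /q; field.
rewrite exprVn; set P := (3 / 4) ^+ j.
have P0 : 0 < P by rewrite exprn_gt0.
move=> /(ler_wpM2l (ltW P0)); rewrite mulrCA mulfV ?gt_eqF// mulr1 => ?.
lra.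
Qed.

(** * Absolute continuity of the curve *)

Definition mass (R : realType) (g : R -> R) (A : set (measurableTypeR R)) : R :=
  \int[@lebesgue_measure R]_(x in A) `|g x|.

Lemma mass_ge0 (R : realType) (g : R -> R) A : 0 <= mass g A.
Proof. exact: Rintegral_ge0. Qed.

Lemma massU (R : realType) (g : R -> R) (A B : set (measurableTypeR R)) :
  (@lebesgue_measure R).-integrable setT (EFin \o g) ->
  measurable A -> measurable B -> [disjoint A & B] ->
  mass g (A `|` B) = mass g A + mass g B.
Proof.
move=> intg mA mB AB; apply: Rintegral_setU => //.
apply: (integrableS measurableT) => //; first exact: measurableU.
exact: integrable_norm.
Qed.

Lemma le_mass (R : realType) (g : R -> R) (A B : set (measurableTypeR R)) :
  (@lebesgue_measure R).-integrable setT (EFin \o g) ->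
  measurable A -> measurable B -> A `<=` B -> mass g A <= mass g B.
Proof.
move=> intg mA mB AB; rewrite -(setDUK AB) massU//.
- by rewrite lerDl mass_ge0.
- exact: measurableD.
- by apply/disj_setPS => x [? []].
Qed.

Lemma mass_subadditive (R : realType) (g : R -> R)
    (A B C : set (measurableTypeR R)) :
  (@lebesgue_measure R).-integrable setT (EFin \o g) ->
  measurable A -> measurable B -> measurable C -> A `<=` B `|` C ->
  mass g A <= mass g B + mass g C.
Proof.
move=> intg mA mB mC ABC.
have mCB : measurable (C `\` B) by exact: measurableD.
apply: (@le_trans _ _ (mass g (B `|` (C `\` B)))).
  apply: le_mass => //; first exact: measurableU.
  by move=> x /ABC; have [Bx|nBx] := pselect (B x); [left|move=> []//; right].
rewrite massU//; last by apply/disj_setPS => x [? []].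
by rewrite lerD2l; apply: le_mass => // x [].
Qed.

Lemma EFin_mass (R : realType) (g : R -> R) (A : set (measurableTypeR R)) :
  (@lebesgue_measure R).-integrable setT (EFin \o g) -> measurable A ->
  (mass g A)%:E = (\int[@lebesgue_measure R]_(x in A) `|g x|%:E)%E.
Proof.
move=> intg mA; rewrite /mass /Rintegral fineK//.
apply: integrable_fin_num => //; apply: (integrableS measurableT) => //.
exact: integrable_norm.
Qed.

Lemma mass_bigsetU (R : realType) (n : nat) (g : R -> R)
    (A : 'I_n -> set (measurableTypeR R)) :
  (@lebesgue_measure R).-integrable setT (EFin \o g) ->
  (forall i, measurable (A i)) -> trivIset setT A ->
  \sum_i mass g (A i) = mass g (\big[setU/set0]_i A i).
Proof.
move=> intg mA tA; have mU : measurable (\big[setU/set0]_i A i).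
  exact: bigsetU_measurable.
apply: EFin_inj; rewrite -sumEFin EFin_mass//.
rewrite ge0_integral_bigsetU//.
- by apply: eq_bigr => i _; rewrite EFin_mass.
- exact: index_enum_uniq.
- exact: sub_trivIset tA.
- apply: (measurable_funS measurableT) => //; apply/measurable_EFinP.
  by apply: measurableT_comp => //; case/integrableP : intg => /measurable_EFinP.
Qed.

Lemma ae_le_mass (R : realType) (f g : R -> R) (A : set (measurableTypeR R)) :
  (@lebesgue_measure R).-integrable setT (EFin \o f) ->
  (@lebesgue_measure R).-integrable setT (EFin \o g) -> measurable A ->
  {ae (@lebesgue_measure R), forall t, A t -> `|f t| <= `|g t|} ->
  mass f A <= mass g A.
Proof.
move=> intf intg mA fg; rewrite -lee_fin !EFin_mass//.
have mabs h : (@lebesgue_measure R).-integrable setT (EFin \o h) ->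
    measurable_fun A (fun x => (`|h x|)%:E).
  move=> inth; apply: (measurable_funS measurableT) => //; apply/measurable_EFinP.
  by apply: measurableT_comp => //; case/integrableP : inth => /measurable_EFinP.
by apply: ae_ge0_le_integral => //; exact: mabs.
Qed.

Lemma has_density_mass (R : realType) (a b : R) (F g : R -> R) (s t : R) :
  has_density a b F g -> a <= s -> s <= t -> t <= b ->
  `|F t - F s| <= mass g `]s, t[%classic.
Proof.
move=> Fg as_ st tb; rewrite (Fg.2 _ _ as_ st tb).
have intn A : measurable A ->
    (@lebesgue_measure R).-integrable A (EFin \o (Num.norm \o g)).
  move=> mA; apply: (integrableS measurableT) => //; apply: integrable_norm.
  exact: Fg.1.
rewrite /mass Rintegral_itv_bndo_bndc; last exact: intn.
by apply: le_normr_Rintegral => //; exact: has_density_integrable Fg.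
Qed.

Lemma mass_small (R : realType) (g : R -> R) (e : R) :
  (@lebesgue_measure R).-integrable setT (EFin \o g) -> 0 < e ->
  exists2 d : R, 0 < d & forall A, measurable A ->
    (lebesgue_measure A < d%:E)%E -> mass g A < e.
Proof.
move=> intg e0; have [d [d0 dP]] := integral_normr_continuous intg e0.
by exists d.
Qed.

(** A large gain on short intervals, combined with matching a near-maximiser [h0] elsewhere, would
    push the mass beyond its supremum. *)
Lemma abs_continuous_on_nonexpansive (R : realType) (X : metricType R) (a b : R)
    (gamma : R -> X) : a <= b -> {within `[a, b], continuous gamma} ->
  (forall h : X -> R, nonexpansive h ->
    @abs_continuous_on R R^o a b (h \o gamma)) ->
  abs_continuous_on a b gamma.
Proof.
move=> ab cgamma ach e e0.
have [C TVC] : exists C : R, forall h : X -> R, nonexpansive h ->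
    (total_variation a b (h \o gamma) <= C%:E)%E.
  apply: nonexpansive_uniform_total_variation => // h /ach.
  exact: abs_continuous_on_bounded_variation.
have /choice[G GP] : forall h : X -> R, exists g, nonexpansive h ->
    has_density a b (h \o gamma) g /\ mass g setT <= C.
  move=> h; have [nh|nnh] := pselect (nonexpansive h); last by exists (fun=> 0).
  have [g hg gTV] := abs_continuous_on_density ab (ach _ nh).
  exists g => _; split => //; apply: le_trans gTV _.
  rewrite -lee_fin fineK ?TVC//.
  exact: abs_continuous_on_bounded_variation (ach _ nh).
have HG h : nonexpansive h -> has_density a b (h \o gamma) (G h).
  by move=> /GP[].
have intG h : nonexpansive h ->
    (@lebesgue_measure R).-integrable setT (EFin \o G h).
  by move=> /HG[].
pose D : set (measurableTypeR R) := `]a, b[%classic.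
have mD : measurable D by exact: measurable_itv.
pose N := [set mass (G h) D | h in [set h | nonexpansive h]].
have supN : has_sup N.
  split; first by exists (mass (G (fun=> 0)) D), (fun=> 0) => // x y;
    rewrite /= subrr normr0 mdist_ge0.
  exists C => _ [h nh <-]; have [_] := GP _ nh; apply: le_trans.
  by apply: le_mass => //; exact: intG.
have e40 : 0 < e / 4 by rewrite divr_gt0.
have [_ [h0 nh0 <-] h0N] := sup_adherent e40 supN.
(* The threshold [d] depends on [h0] alone and is fixed before the intervals are given. *)
have [d d0 h0d] := mass_small (intG _ nh0) e40.
exists d => // n u v uv tuv uvd.
pose J i : set (measurableTypeR R) := `]u i, v i[%classic.
have mJ i : measurable (J i) by exact: measurable_itv.
have JD i : J i `<=` D.
  have [au [_ vb]] := uv i; move=> x; rewrite /J /D /= !in_itv/=.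
  by move=> /andP[ux xv]; rewrite (le_lt_trans au ux) (lt_le_trans xv vb).
(* The list to dominate: [h0] at index 0, the distance from [gamma (u i)] at index [i.+1], and [h0]
   again as the default beyond [n]. *)
pose f (k : nat) : X -> R := if k is i.+1 then
  (if insub i is Some j then mdist (gamma (u (j : 'I_n))) else h0) else h0.
have fE (i : 'I_n) : f i.+1 = mdist (gamma (u i)) by rewrite /f valK.
have nf k : nonexpansive (f k).
  case: k => [//|k] /=; case: insubP => [j _ _|//].
  exact: nonexpansive_mdist.
have e4n0 : 0 < e / 4 / n.+1%:R by rewrite divr_gt0.
have /choice[r rP] : forall k, exists r, 0 < r /\ forall A, measurable A ->
    (lebesgue_measure A < r%:E)%E -> mass (G (f k)) A < e / 4 / n.+1%:R.
  move=> k; have [r r0 rP] := mass_small (intG _ (nf k)) e4n0.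
  by exists r.
(* One threshold serving all [f k] with [k <= n]; [eta / 2] is used below since [E] is bounded only
   weakly while [mass_small] needs a strict bound. *)
pose eta := \big[Num.min/1]_(k < n.+1) r k.
have eta0 : 0 < eta by rewrite lt_bigmin// => k _; exact: (rP k).1.
have eta20 : 0 < eta / 2 by rewrite divr_gt0.
have [h [E [nh mE Eeta ae_h]]] := nonexpansive_density_bigmax cgamma HG n nf eta20.
have smallE k : (k <= n)%N -> mass (G (f k)) E < e / 4 / n.+1%:R.
  move=> kn; apply: (rP k).2 => //; apply: le_lt_trans Eeta _.
  rewrite lte_fin; apply: (@lt_le_trans _ _ eta).
    by rewrite ltr_pdivrMr// ltr_pMr// ltr1n.
  exact: (bigmin_le 1 (Ordinal (kn : (k < n.+1)%N)) (fun i => r i)).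
have dominate k (A : set (measurableTypeR R)) :
    (k <= n)%N -> measurable A -> A `<=` D ->
    mass (G (f k)) (A `\` E) <= mass (G h) (A `\` E).
  move=> kn mA AD; apply: ae_le_mass; [exact: intG|exact: intG| |].
    exact: measurableD.
  apply: lebesgue_ae_impl ae_h => t th [/AD + nEt].
  by rewrite /D /= in_itv/= => /andP[at_ tb]; exact: th.
pose JE i := J i `\` E.
have mJE i : measurable (JE i) by exact: measurableD.
pose U := \big[setU/set0]_i J i.
have mU : measurable U by exact: bigsetU_measurable.
pose W := \big[setU/set0]_i JE i.
have mW : measurable W by exact: bigsetU_measurable.
have WU : W `<=` U.
  rewrite /W /U -!bigcup_seq => x [i si [Jx _]]; exists i => //.
(* On [W] the density of [h] dominates those of the distance functions, on [V] that of [h0]. *)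
pose V := D `\` U `\` E.
have mV : measurable V by apply: measurableD => //; exact: measurableD.
have Ud : (lebesgue_measure U < d%:E)%E.
  apply: (@le_lt_trans _ _ (\sum_i (v i - u i))%:E); last by rewrite lte_fin.
  suff : measurable U /\ (lebesgue_measure U <= (\sum_i (v i - u i))%:E)%E by case.
  rewrite /U; apply: (big_ind2 (fun A (x : R) =>
    measurable A /\ (lebesgue_measure A <= x%:E)%E)).
  - by split => //; rewrite measure0.
  - move=> A x B y [mA Ax] [mB By]; split; first exact: measurableU.
    by rewrite EFinD (le_trans (measureU2 _ _ _))// leeD.
  - move=> i _; split => //; rewrite /J lebesgue_measure_itv/= lte_fin.
    by have [_ [uvi _]] := uv i; rewrite uvi -EFinB.
have sumW : \sum_i mass (G h) (JE i) = mass (G h) W.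
  apply: mass_bigsetU => //; first exact: intG.
  apply/trivIsetP => i j _ _ ij; move/trivIsetP : tuv => /(_ i j Logic.I Logic.I ij).
  by apply: subsetI_eq0 => x [].
have step i : mdist (gamma (u i)) (gamma (v i)) <=
    mass (G h) (JE i) + e / 4 / n.+1%:R.
  have [au [uvi vb]] := uv i.
  (* The distance from [gamma (u i)] vanishes at its base point, so its increment over [J i] is the
     distance to be bounded. *)
  have := has_density_mass (HG _ (nf i.+1)) au (ltW uvi) vb.
  rewrite fE /= mdistxx subr0 (ger0_norm (mdist_ge0 _ _)) => /le_trans; apply.
  apply: (@le_trans _ _ (mass (G (f i.+1)) (JE i) + mass (G (f i.+1)) E)).
    rewrite -fE; apply: mass_subadditive => //; first exact: intG.
    by move=> x Jx; have [Ex|nEx] := pselect (E x); [right|left].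
  apply: lerD; first exact: dominate.
  by apply/ltW/smallE.
have sumstep : \sum_i mdist (gamma (u i)) (gamma (v i)) <= mass (G h) W + e / 4.
  apply: le_trans (ler_sum _ (fun i _ => step i)) _.
  rewrite big_split/= sumW lerD2l sumr_const card_ord -[_ *+ n]mulr_natr.
  rewrite -mulrA ger_pMr// mulrC ler_pdivrMr// mul1r.
  by rewrite ler_nat.
have h0D : mass (G h0) D <= mass (G h0) U + (mass (G h0) E + mass (G h) V).
  apply: (@le_trans _ _ (mass (G h0) U + (mass (G h0) E + mass (G h0) V))).
    apply: le_trans (mass_subadditive (intG _ nh0) mD mU (measurableU _ _ mE mV) _) _.
      move=> x Dx; have [Ux|nUx] := pselect (U x); first by left.
      by right; have [Ex|nEx] := pselect (E x); [left|right].
    rewrite lerD2l; apply: mass_subadditive => //; [exact: intG|exact: measurableU].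
  rewrite !lerD2l; apply: (dominate 0%N) => //; exact: measurableD.
have hWV : mass (G h) W + mass (G h) V <= sup N.
  rewrite -massU//; last 2 first.
  - exact: intG.
  - by apply/disj_setPS => x [/WU Ux [[_ nUx] _]].
  apply: (@le_trans _ _ (mass (G h) D)); last first.
    by apply: ub_le_sup; [exact: supN.2|exists h].
  apply: le_mass => //; [exact: intG|exact: measurableU|].
  move=> x [|[[]]//]; rewrite /W -bigcup_seq => -[i _ [Jx _]].
  exact: JD Jx.
have h0U : mass (G h0) U < e / 4 by exact: h0d.
have h0E : mass (G h0) E < e / 4.
  apply: lt_le_trans (smallE 0%N isT) _.
  by rewrite ler_pdivrMr// ler_peMr ?ler1n// ltW.
(* From [sup N - e / 4 < mass (G h0) D < e / 2 + mass (G h) V] and [hWV],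
   [mass (G h) W < 3 / 4 * e]; then [sumstep] adds [e / 4]. *)
lra.
Qed.

Theorem theorem1 (R : realType) (X : metricType R) (a b : R) (hab : a <= b)
    (gamma : R -> X) (hgamma : {within `[a, b], continuous gamma}) :
  abs_continuous_on a b gamma <->
  (forall h : X -> R, metric_lipschitz h ->
     @abs_continuous_on R R^o a b (h \o gamma)).
Proof.
split=> [acg h [L L0 hL] e e0|ach].
  (* Dividing by [L + 1] is safe even when [L = 0]. *)
  have L10 : 0 < L + 1 by rewrite ltr_wpDl.
  have [d d0 gd] := acg _ (divr_gt0 e0 L10).
  exists d => // n u v uv tuv uvd.
  have := gd n u v uv tuv uvd; rewrite ltr_pdivlMr//; apply: le_lt_trans.
  rewrite mulr_suml; apply: ler_sum => i _.
  rewrite -[leLHS]/(`|h (gamma (v i)) - h (gamma (u i))|) distrC.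
  apply: le_trans (hL _ _) _; rewrite mulrC; apply: ler_wpM2l; first exact: mdist_ge0.
  by rewrite lerDl.
apply: abs_continuous_on_nonexpansive => // h nh; apply: ach.
by exists 1 => // x y; rewrite mul1r; exact: nh.
Qed.
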